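(* Let $q$ be a complex number with $0<|q|<1$, let $r$ be a nonnegative integer, and let $a$ and $b_1,\dots,b_{2r+1}$ be complex numbers with $\max\left\{\left|\frac{a^rq^r}{b_1b_2\cdots b_{2r+1}}\right|,\left|\frac{q^{2r}}{b_1b_2\cdots b_{2r+1}}\right|\right\}<1$ (where $a$ is the variable of the limit below). Then $$\lim_{a\to q}\;{}_{2r+4}W_{2r+3}\!\left(a;b_1,\dots,b_{2r+1};q,\frac{a^rq^r}{b_1\cdots b_{2r+1}}\right)=\frac1{1-q}\;{}_{2r+1}\psi_{2r+1}\!\left[\begin{matrix}b_1,\dots,b_{2r+1}\\ q^2/b_1,\dots,q^2/b_{2r+1}\end{matrix};q,\frac{q^{2r}}{b_1\cdots b_{2r+1}}\right].$$
   Context: Notation. $(x;q)_\infty=\prod_{i=0}^\infty(1-xq^i)$ and, for every integer $n$, $(x;q)_n=(x;q)_\infty/(xq^n;q)_\infty$, i.e. $(x;q)_n=\prod_{i=0}^{n-1}(1-xq^i)$ for $n\ge0$ and $(x;q)_{-n}=\prod_{i=1}^{n}(1-xq^{-i})^{-1}$ for $n\geq 1$. For several parameters, $(x_1,\dots,x_s;q)_m=(x_1;q)_m\cdots(x_s;q)_m$. Very-well-poised series: for $n$ parameters $\beta_1,\dots,\beta_n$, $${}_{n+3}W_{n+2}(\alpha;\beta_1,\dots,\beta_n;q,z)=\sum_{k=0}^\infty\frac{(\alpha,q\sqrt\alpha,-q\sqrt\alpha,\beta_1,\dots,\beta_n;q)_k}{(q,\sqrt\alpha,-\sqrt\alpha,\alpha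 q/\beta_1,\dots,\alpha q/\beta_n;q)_k}z^k,\qquad \frac{(q\sqrt\alpha,-q\sqrt\alpha;q)_k}{(\sqrt\alpha,-\sqrt\alpha;q)_k}=\frac{1-\alpha q^{2k}}{1-\alpha}.$$ Bilateral series: ${}_s\psi_s\!\left[\begin{matrix}a_1,\dots,a_s\\ c_1,\dots,c_s\end{matrix};q,z\right]=\sum_{k=-\infty}^{\infty}\frac{(a_1,\dots,a_s;q)_k}{(c_1,\dots,c_s;q)_k}z^k.$ Standing convention: the parameters are such that every expression occurring is well defined (no denominator vanishes, including the denominator factors of the terms of the series). *)

(* Defs.v *)
From HB Require Import structures.
From mathcomp Require Import all_boot all_order all_algebra.
From mathcomp Require Import all_classical all_reals all_analysis.
From mathcomp Require Import complex.
Set Implicit Arguments.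
Unset Strict Implicit.
Unset Printing Implicit Defensive.
Import Order.TTheory GRing.Theory Num.Theory numFieldNormedType.Exports.
Local Open Scope classical_set_scope.
Local Open Scope ring_scope.

(* The notation R[i] has no canonical topology by itself; packing it as a
   numClosedFieldType gives it the one induced by its norm. *)
Definition cplx (R : realType) : numClosedFieldType := R[i]%C.

Section BasicHypergeometric.
Variable C : numClosedFieldType.
Implicit Types (x q z alpha : C) (xs a c beta : seq C) (n : int).

(* (x;q)_n for an integer n; Negz m is -(m+1). Since 0^-1 = 0, the quantity
   1/(x;q)_(-m) always equals \prod_(1 <= i < m.+1) (1 - x * q ^- i), also
   when one of these factors vanishes. *)
Definition qpoch x q n : C :=
  match n with
  | Posz m => \prod_(0 <= i < m) (1 - x * q ^+ i)
  | Negz m => \prod_(1 <= i < m.+2) (1 - x * q ^- i)^-1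
  end.

Definition qpochs xs q n : C := \prod_(x <- xs) qpoch x q n.

Definition W_term alpha beta q z (k : nat) : C :=
  qpochs [:: alpha, q * sqrtC alpha, - (q * sqrtC alpha) & beta] q k%:Z
  / qpochs [:: q, sqrtC alpha, - sqrtC alpha
             & [seq alpha * q / x | x <- beta]] q k%:Z
  * z ^+ k.

Definition W alpha beta q z : C := limn (series (W_term alpha beta q z)).

Definition bilateral_cvg (u : int -> C) : Prop :=
  cvgn (series (fun k : nat => u (Posz k))) /\
  cvgn (series (fun k : nat => u (Negz k))).

Definition bilateral_sum (u : int -> C) : C :=
  limn (series (fun k : nat => u (Posz k))) +
  limn (series (fun k : nat => u (Negz k))).

Definition psi_term a c q z (k : int) : C :=
  qpochs a q k / qpochs c q k * z ^ k.

Definition psi a c q z : C := bilateral_sum (psi_term a c q z).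

(* The factors occurring in a denominator are those of (c_j;q)_k for k >= 0,
   and those of (a_j;q)_k for k < 0; the factors of (c_j;q)_k for k < 0 end up
   in the numerator of the term, so they may vanish. *)
Definition psi_defined a c q : Prop :=
  (forall y (i : nat), y \in c -> 1 - y * q ^+ i != 0) /\
  (forall x (i : nat), x \in a -> (1 <= i)%N -> 1 - x * q ^- i != 0).

End BasicHypergeometric.

(* Main.v *)
Require Import Defs.
From mathcomp Require Import all_boot all_order all_algebra.
From mathcomp Require Import all_classical all_reals all_analysis.
From mathcomp Require Import complex.
From mathcomp Require Import ring.
Set Implicit Arguments.
Unset Strict Implicit.
Unset Printing Implicit Defensive.
Import Order.TTheory GRing.Theory Num.Theory numFieldNormedType.Exports.
Local Open Scope classical_set_scope.
Local Open Scope ring_scope.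

(* Write t_k(a) for the k-th term of W and z(a) for its argument. The quotient
   t_{k+1}(a) / t_k(a) is a rational function of a and u = q^k which is
   continuous at (a, u) = (q, 0) with value z(q), of modulus < 1. Hence near
   a = q all terms of large index decrease by a common factor rho < 1, so the
   sum of the series is continuous at a = q.
   On the other side, the reflection k -> -k-1 multiplies the k-th term T_k of
   the bilateral series by -q^(2k+1), and t_k(q) = (1 - q^(2k+1)) / (1 - q) T_k:
   folding the bilateral series gives (1 - q) times the value of W at a = q. *)

(** * Completeness of the complex numbers, inherited from the reals *)

Section ComplexCompleteness.
Variable R : realType.

Lemma cvg_real_complex T (F : set_system T) (FF : Filter F)
    (f : T -> R) (l : R) :
  f x @[x --> F] --> l ->
  ((f x)%:C%C : cplx R) @[x --> F] --> (l%:C%C : cplx R).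
Proof.
move=> fl; apply/cvgrPdist_lt => e e0.
(* The order on complex numbers makes a positive [e] real, so the estimate can be carried out in
   [R]. *)
have eE : e = ((complex.Re e)%:C)%C by rewrite RRe_real// gtr0_real.
have e0' : 0 < complex.Re e by rewrite eE in e0; rewrite -ltcR.
near=> x; rewrite /= -rmorphB/=.
have -> : `|(l - f x)%:C%C : cplx R| = (`|l - f x|)%:C%C.
  by rewrite normc_def/= expr0n addr0 sqrtr_sqr.
rewrite eE ltcR; near: x; exact: cvgr_dist_lt fl _ e0'.
Unshelve. all: by end_near. Qed.

(** Real and imaginary parts are 1-Lipschitz, so they send a Cauchy filter to Cauchy filters on [R];
    the two real limits are then recombined. *)
Lemma cplx_cauchy_cvg (F : set_system (cplx R)) :
  ProperFilter F -> cauchy F -> cvg F.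
Proof.
move=> FF /cauchy_ballP cF.
have key (p : cplx R -> R) : (forall z w, (`|p z - p w|)%:C%C <= `|z - w|) ->
    cvg (p z @[z --> F]).
  move=> pP; apply/cauchy_cvgP/cauchy_ballP => e e0.
  have /cF[[A B] /= [FA FB] AB] : 0 < (e%:C%C : cplx R) by rewrite ltcR.
  exists (p @` A, p @` B) => /=.
    split; [apply: filterS FA | apply: filterS FB]; exact: preimage_image.
  move=> [_ _] /= [[z Az <-] [w Bw <-]]; have /= := AB (z, w) (conj Az Bw).
  by rewrite -!ball_normE/= => /(le_lt_trans (pP z w)); rewrite ltcR.
have /cvg_ex[a ReF] : cvg (complex.Re z @[z --> F]).
  by apply: key => z w; rewrite -raddfB/= normc_ge_Re.
have /cvg_ex[b ImF] : cvg (complex.Im z @[z --> F]).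
  apply: key => z w; rewrite -raddfB/= -normrN -ReiNIm.
  by rewrite (le_trans (normc_ge_Re _))// normrM complexiE normCi mulr1.
apply/cvg_ex; exists (a%:C + 'i * b%:C)%C.
rewrite [X in X --> _](_ : _ =
    ((complex.Re z)%:C + 'i * (complex.Im z)%:C)%C @[z --> F]).
  apply: cvgD; first exact: cvg_real_complex.
  by apply: cvgMr; exact: cvg_real_complex.
rewrite -[LHS]/(id @ F); congr (_ @ F); apply/funext => z; exact: complexE.
Qed.
End ComplexCompleteness.

(** * Ratio test, and its version uniform in a parameter *)

Section RatioTest.
Variable R : realType.
Implicit Types (u : nat -> cplx R) (rho z : cplx R).

Lemma cplx_cvg_expr z : `|z| < 1 -> z ^+ n @[n --> \oo] --> (0 : cplx R).
Proof.
move=> z1; apply/norm_cvg0P.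
have zE : `|z| = ((complex.Re `|z|)%:C)%C by rewrite RRe_real// normr_real.
have -> : (fun n => `|z ^+ n|) = (fun n => ((complex.Re `|z|) ^+ n)%:C%C).
  by apply/funext => n; rewrite normrX [in LHS]zE rmorphXn.
apply: (@cvg_real_complex R nat \oo _ _ 0); apply: cvg_expr.
have : `|complex.Re `|z| |%:C%C < (1 : R)%:C%C.
  by apply: (le_lt_trans (normc_ge_Re _)); rewrite normr_id.
by rewrite ltcR.
Qed.

Section RatioBound.
Variables (u : nat -> cplx R) (rho : cplx R) (N : nat).
Hypotheses (rho0 : 0 <= rho) (rho1 : rho < 1).
Hypothesis uS : forall k, (N <= k)%N -> `|u k.+1| <= rho * `|u k|.

Lemma ratio_term_bound n j : (N <= n)%N -> `|u (n + j)%N| <= `|u n| * rho ^+ j.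
Proof.
move=> Nn; elim: j => [|j IH]; first by rewrite addn0 mulr1.
rewrite addnS (le_trans (uS _)) ?(leq_trans Nn (leq_addr _ _))//.
by rewrite exprS mulrCA ler_wpM2l.
Qed.

Lemma ratio_partial_bound n m : (N <= n)%N -> (n <= m)%N ->
  `|series u m - series u n| <= `|u n| / (1 - rho).
Proof.
move=> Nn nm; rewrite -(subnKC nm); set j := (m - n)%N.
have r1 : 0 < 1 - rho by rewrite subr_gt0.
(* The exact finite geometric sum is what passes through the induction on [j]; the bound
   [1 / (1 - rho)] alone would not. *)
suff : `|series u (n + j)%N - series u n| <=
    `|u n| * ((1 - rho ^+ j) / (1 - rho)).
  move/le_trans; apply; rewrite ler_wpM2l// ler_pdivrMr// mulVf ?gt_eqF//.
  by rewrite gerBl exprn_ge0.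
elim: j => [|j IH]; first by rewrite addn0 !subrr normr0 mul0r mulr0.
rewrite addnS seriesSr addrAC (le_trans (ler_normD _ _))//.
rewrite (le_trans (lerD IH (ratio_term_bound j Nn)))// -mulrDr ler_wpM2l//.
rewrite le_eqVlt; apply/orP; left; apply/eqP.
rewrite exprS; field; exact: lt0r_neq0.
Qed.

Lemma ratio_cvg_series : cvgn (series u).
Proof.
apply: cplx_cauchy_cvg; apply/cauchy_ballP => e e0.
have r1 : 0 < 1 - rho by rewrite subr_gt0.
(* Once a term is below this threshold, [ratio_partial_bound] keeps all later partial sums within
   [e / 2] of the current one. *)
have d0 : 0 < e * (1 - rho) / 2 by rewrite divr_gt0// mulr_gt0.
have un0 : u n @[n --> \oo] --> (0 : cplx R).
  rewrite -(cvg_shiftn N).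
  have vn0 : `|u N| * rho ^+ n @[n --> \oo] --> (0 : cplx R).
    rewrite -[X in _ --> X](mulr0 `|u N|); apply: cvgM; first exact: cvg_cst.
    by apply: cplx_cvg_expr; rewrite ger0_norm.
  apply/cvgr0Pnorm_le => d d0'; near=> n.
  rewrite /= addnC (le_trans (ratio_term_bound n (leqnn N)))//.
  rewrite -[leLHS]ger0_norm ?mulr_ge0 ?exprn_ge0//.
  by near: n; exact: cvgr0_norm_le _ vn0 _ d0'.
have [M _ MP] := cvgr0_norm_lt _ un0 _ d0.
pose n := maxn M N.
have un : `|u n| / (1 - rho) < e / 2.
  by rewrite ltr_pdivrMr// mulrAC; exact/MP/leq_maxl.
pose B := [set y | `|y - series u n| < e / 2].
have FB : \forall m \near \oo, B (series u m).
  exists n => // m /= nm; apply: le_lt_trans un.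
  by apply: ratio_partial_bound => //; exact: leq_maxr.
exists (B, B) => // -[y y'] /= [By By'].
rewrite -ball_normE /= -(subrKA (series u n)) (splitr e).
by rewrite (le_lt_trans (ler_normD _ _))// ltrD// distrC.
Unshelve. all: by end_near. Qed.

Lemma ratio_tail_bound n : (N <= n)%N ->
  `|limn (series u) - series u n| <= `|u n| / (1 - rho).
Proof.
move=> Nn; apply/ler_addgt0Pr => e e0.
have /cvgrPdist_le/(_ _ e0)[M _ HM] : series u @ \oo --> limn (series u).
  exact: ratio_cvg_series.
rewrite -(subrKA (series u (maxn M n))) addrC.
apply: le_trans (ler_normD _ _) _; apply: lerD; last exact/HM/leq_maxl.
by apply: ratio_partial_bound => //; exact: leq_maxr.
Qed.

End RatioBound.

Lemma ratio_limit_cvg_series u (g : nat -> cplx R) z :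
  (forall k, u k.+1 = g k * u k) -> g k @[k --> \oo] --> z -> `|z| < 1 ->
  cvgn (series u).
Proof.
move=> uS gz z1.
have [zr r1] := midf_lt z1.
have [N _ gN] := cvgr_norm_le _ gz _ zr.
apply: (@ratio_cvg_series _ _ N _ r1) => [|k Nk].
  exact: le_trans (normr_ge0 z) (ltW zr).
by rewrite uS normrM ler_wpM2r// gN.
Qed.

(** The joint limit of the ratios in [x] and [k] yields a single [rho < 1] and a single rank [N] for
    all [x] near [x0]. The tails are then uniformly small, and a finite partial sum is continuous at
    [x0]. *)
Lemma ratio_series_continuous (T : topologicalType) (x0 : T)
    (f g : T -> nat -> cplx R) z :
  (forall x k, f x k.+1 = g x k * f x k) ->
  (forall k, f x k @[x --> x0] --> f x0 k) ->
  g p.1 p.2 @[p --> (nbhs x0, \oo)] --> z -> `|z| < 1 ->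
  (\forall x \near x0, cvgn (series (f x))) /\
  limn (series (f x)) @[x --> x0] --> limn (series (f x0)).
Proof.
move=> fS fc gz z1.
have [zr r1] := midf_lt z1; set rho := (_ / 2) in zr r1.
have rho0 : 0 <= rho := le_trans (normr_ge0 z) (ltW zr).
(* A set of the product filter contains a rectangle: a neighbourhood [A] of [x0] times the integers
   from [N] on. *)
have [[A B] /= [xA [N _ NB]] AB] := cvgr_norm_le _ gz _ zr.
have {AB} fN x : A x -> forall k, (N <= k)%N -> `|f x k.+1| <= rho * `|f x k|.
  move=> Ax k Nk; rewrite fS normrM ler_wpM2r//; apply: (AB (x, k)).
  by split => //; exact: NB.
have Ax0 : A x0 by exact: nbhs_singleton.
split; first by apply: filterS xA => x /fN; exact: ratio_cvg_series.
apply/(@cvgrPdist_le _ (cplx R) T (nbhs x0)) => e e0.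
(* After division by [1 - rho] in [ratio_tail_bound], each of the two tails costs at most [e / 3];
   the partial sums account for the last third. *)
have d0 : 0 < e / 3 * (1 - rho) by rewrite mulr_gt0 ?divr_gt0// subr_gt0.
have fx00 : f x0 n @[n --> \oo] --> (0 : cplx R).
  exact: cvg_series_cvg_0 (ratio_cvg_series rho0 r1 (fN _ Ax0)).
have [M _ MP] := cvgr0_norm_lt _ fx00 _ d0.
pose n := maxn M N.
have Nn : (N <= n)%N by exact: leq_maxr.
have fn0 : `|f x0 n| < e / 3 * (1 - rho) by exact/MP/leq_maxl.
have fn : \forall x \near x0, `|f x n| < e / 3 * (1 - rho).
  exact: cvgr_norm_lt _ (fc n) _ fn0.
have Sn : series (f x) n @[x --> x0] --> series (f x0) n.
  by apply: (cvg_big add_continuous) => k _; exact: fc.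
have e3 : 0 < e / 3 by rewrite divr_gt0.
near=> x.
have Ax : A x by near: x.
have tail y : A y -> `|f y n| < e / 3 * (1 - rho) ->
    `|limn (series (f y)) - series (f y) n| <= e / 3.
  move=> Ay fyn; apply: le_trans (ratio_tail_bound rho0 r1 (fN _ Ay) Nn) _.
  by rewrite ler_pdivrMr ?subr_gt0// ltW.
rewrite -(subrKA (series (f x0) n)) -(subrKA (series (f x) n) (series (f x0) n)).
rewrite (_ : e = e / 3 + (e / 3 + e / 3)); last by field.
apply: le_trans (ler_normD _ _) _; apply: lerD; first exact: tail.
apply: le_trans (ler_normD _ _) _; apply: lerD.
  by near: x; exact: cvgr_dist_le _ _ Sn _ e3.
by rewrite distrC; apply: tail => //; near: x.
Unshelve. all: by end_near. Qed.
End RatioTest.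

(** * Recurrences for the terms, and the reflection of the bilateral series *)

Section TermRatios.
Variable C : numClosedFieldType.
Implicit Types (a q u x z : C) (b xs : seq C).

Lemma qpochsS xs q (k : nat) :
  qpochs xs q k.+1%:Z = qpochs xs q k%:Z * \prod_(x <- xs) (1 - x * q ^+ k : C).
Proof.
rewrite /qpochs -big_split/=; apply: eq_bigr => x _.
by rewrite /qpoch big_nat_recr.
Qed.

Lemma qpochs0 xs q : qpochs xs q 0%:Z = 1.
Proof. by rewrite /qpochs big1// => x _; rewrite /qpoch big_geq. Qed.

Lemma qpochs_NegzS xs q (k : nat) :
  qpochs xs q (Negz k.+1) =
  qpochs xs q (Negz k) * \prod_(x <- xs) (1 - x * q ^- k.+2 : C)^-1.
Proof.
rewrite /qpochs -big_split/=; apply: eq_bigr => x _.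
by rewrite /qpoch big_nat_recr.
Qed.

(** Here [u] stands for [q ^+ k]. The index enters the ratios only through [u], so that [k -> oo]
    becomes continuity at [u = 0]. For [a = q] the lower parameters are those of the bilateral
    series. *)
Definition psi_ratio a b q u : C :=
  \prod_(x <- b) ((1 - x * u) / (1 - a * q / x * u)).

Definition W_ratio a b q z u : C :=
  (1 - a * u) / (1 - q * u) * ((1 - a * q ^+ 2 * u ^+ 2) / (1 - a * u ^+ 2))
  * psi_ratio a b q u * z.

Lemma W_term0 a b q z : W_term a b q z 0 = 1.
Proof. by rewrite /W_term !qpochs0 divr1 mulr1. Qed.

(** Inversion is multiplicative even at 0, so this recursion holds for every [a], as the uniform
    ratio test requires. *)
Lemma W_termS a b q z k :
  W_term a b q z k.+1 = W_ratio a b q z (q ^+ k) * W_term a b q z k.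
Proof.
rewrite /W_term /W_ratio /psi_ratio !qpochsS !big_cons big_map prodf_div exprS.
set P : C := \prod_(x <- b) _; set Q : C := \prod_(x <- b) _.
set A := qpochs _ _ _; set B := qpochs _ _ _.
set s := sqrtC a; set u := q ^+ k.
(* The factors with [s] and [- s] pair up into differences of squares, which removes the square root
   from the ratio. *)
have sa : a = s ^+ 2 by rewrite sqrtCK.
have -> : 1 - a * q ^+ 2 * u ^+ 2 = (1 - q * s * u) * (1 - - (q * s) * u).
  by rewrite sa; ring.
have -> : 1 - a * u ^+ 2 = (1 - s * u) * (1 - - s * u) by rewrite sa; ring.
by rewrite !invfM; ring.
Qed.

Lemma psi_termS b q z (k : nat) :
  psi_term b [seq q ^+ 2 / x | x <- b] q z k.+1%:Z =
  psi_ratio q b q (q ^+ k) * z * psi_term b [seq q ^+ 2 / x | x <- b] q z k%:Z.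
Proof.
rewrite /psi_term /psi_ratio !qpochsS big_map prodf_div -!exprnP.
rewrite (exprS z) -expr2.
by rewrite !invfM; ring.
Qed.

(** At [a = q] the factor [(a;q)_k / (q;q)_k] is 1, and the very-well-poised factor becomes
    [(1 - q ^+ (2 * k).+1) / (1 - q)]. *)
Lemma psi_term_W_term b q z (k : nat) :
  (forall i : nat, 1 - q ^+ i.+1 != 0) ->
  (1 - q)^-1 * (1 - q ^+ (2 * k).+1) *
    psi_term b [seq q ^+ 2 / x | x <- b] q z k%:Z = W_term q b q z k.
Proof.
move=> q1; elim: k => [|k IH].
  by rewrite W_term0 /psi_term !qpochs0 divr1 !mulr1 mulVf// (q1 0).
rewrite W_termS -IH psi_termS /W_ratio; set P := psi_ratio _ _ _ _.
rewrite (divff (_ : 1 - q * q ^+ k != 0)); last by rewrite -exprS q1.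
have -> : q * q ^+ 2 * (q ^+ k) ^+ 2 = q ^+ (2 * k.+1).+1.
  by rewrite -exprS -exprM -exprD mulnC mulnS.
have -> : q * (q ^+ k) ^+ 2 = q ^+ (2 * k).+1 by rewrite -exprM mulnC -exprS.
field; by rewrite q1 (q1 0).
Qed.

Lemma psi_term_NegzS b q z (k : nat) :
  psi_term b [seq q ^+ 2 / x | x <- b] q z (Negz k.+1) =
  \prod_(x <- b) ((1 - q ^+ 2 / x * q ^- k.+2) / (1 - x * q ^- k.+2)) / z *
  psi_term b [seq q ^+ 2 / x | x <- b] q z (Negz k).
Proof.
rewrite /psi_term !qpochs_NegzS big_map prodf_div !prodfV.
rewrite -[z ^ Negz k.+1]/(z ^- k.+2) -[z ^ Negz k]/(z ^- k.+1) (exprS z).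
by rewrite !invfM !invrK; ring.
Qed.

(** Apply [1 - c = - c * (1 - c^-1)] to numerator and denominator: inverting [c] turns each into the
    factor of the other parameter at the nonnegative index [k]. *)
Lemma reflect_factor q x (k : nat) : q != 0 -> x != 0 ->
  1 - q ^+ 2 / x * q ^+ k != 0 ->
  (1 - q ^+ 2 / x * q ^- k.+2) / (1 - x * q ^- k.+2) =
  q ^+ 2 / x ^+ 2 * ((1 - x * q ^+ k) / (1 - q ^+ 2 / x * q ^+ k)).
Proof.
move=> q0 x0; rewrite !exprS expr0 mulr1; set u := q ^+ k => D0.
have u0 : u != 0 by rewrite expf_neq0.
have -> : 1 - q * q / x / (q * (q * u)) = - (u * x)^-1 * (1 - x * u).
  by field; rewrite u0 x0 q0.
have -> : 1 - x / (q * (q * u)) = - (x / (q * (q * u))) * (1 - q * q / x * u).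
  by field; rewrite u0 x0 q0.
set D := 1 - q * q / x * u in D0 *.
by field; rewrite D0 u0 x0 q0.
Qed.

Lemma psi_term_Negz r (b : (2 * r + 1).-tuple C) q (k : nat) : q != 0 ->
  (forall x, x \in b -> x != 0) ->
  psi_defined b [seq q ^+ 2 / x | x <- b] q ->
  let z := q ^+ (2 * r) / \prod_(x <- b) x in
  psi_term b [seq q ^+ 2 / x | x <- b] q z (Negz k) =
  - q ^+ (2 * k).+1 * psi_term b [seq q ^+ 2 / x | x <- b] q z k%:Z.
Proof.
move=> q0 b0 [bc ba] z.
have B0 : \prod_(x <- b) x != 0 by rewrite prodf_seq_neq0; apply/allP => x /b0.
have prod_const (c : C) : \prod_(x <- b) c = c ^+ (2 * r + 1).
  by rewrite big_const_seq count_predT size_tuple -Monoid.iteropE.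
elim: k => [|k IH].
  (* At index -1 each parameter contributes [- q / x]. Their number is odd, which produces the minus
     sign, and [z^-1] cancels all but one power of [q]. *)
  rewrite /psi_term !qpochs0 divr1 mulr1 mulr1 /qpochs /qpoch big_map -prodf_div.
  rewrite (eq_big_seq (fun x => - q / x)) => [|x xb]; last first.
    have := ba x 1 xb isT; rewrite !big_nat1 !expr1 invrK => qx.
    have x0 := b0 x xb.
    have -> : 1 - x / q = - (x / q) * (1 - q / x) by field; rewrite x0 q0.
    have qx' : 1 - q / x != 0.
      apply: contra_neq qx => /eqP; rewrite subr_eq0 => /eqP qx1.
      by rewrite -invf_div -qx1 invr1 subrr.
    rewrite (_ : q ^+ 2 / x / q = q / x); last by field; rewrite x0 q0.
    by set D := 1 - q / x in qx' *; field; rewrite qx' x0 q0.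
  rewrite prodf_div prod_const -[z ^ _]/(z^-1) /z.
  have -> : (- q) ^+ (2 * r + 1) = - (q ^+ (2 * r) * q).
    by rewrite exprD expr1 exprM sqrrN -exprM mulrN.
  rewrite muln0 expr1.
  have := expf_neq0 (2 * r) q0; set w := q ^+ _ => w0.
  by field; rewrite w0 B0.
(* The product of the factors [q ^+ 2 / x ^+ 2] is [q ^+ 2 * z ^+ 2]; after division by [z], the
   ratio on the negative side is [q ^+ 2] times the one on the positive side. *)
rewrite psi_term_NegzS IH psi_termS.
rewrite (eq_big_seq (fun x => q ^+ 2 / x ^+ 2 *
    ((1 - x * q ^+ k) / (1 - q ^+ 2 / x * q ^+ k)))); last first.
  by move=> x xb; apply: reflect_factor => //; [exact: b0|apply: bc; exact: map_f].
rewrite big_split/= prodf_div prod_const prodrXl.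
rewrite {1}/psi_ratio -expr2 -/(psi_ratio q b q (q ^+ k)).
move: (psi_ratio _ _ _ _) (psi_term _ _ _ _ _) => P t.
have -> : (q ^+ 2) ^+ (2 * r + 1) = (q ^+ (2 * r)) ^+ 2 * q ^+ 2.
  by rewrite -exprM mulnC mulnDl exprD exprM.
have -> : q ^+ (2 * k.+1).+1 = q ^+ 2 * q ^+ (2 * k).+1.
  by rewrite mulnS -exprD.
rewrite /z; have := expf_neq0 (2 * r) q0; set w := q ^+ (2 * r) => w0.
set v := q ^+ (2 * k).+1; set s := q ^+ 2.
by field; rewrite w0 B0.
Qed.
End TermRatios.

(** * Limits of the ratios and of the individual terms *)

Lemma cvg_expn (K : numFieldType) T (F : set_system T) (FF : Filter F)
    (f : T -> K) (l : K) n :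
  f t @[t --> F] --> l -> f t ^+ n @[t --> F] --> l ^+ n.
Proof.
move=> fl; elim: n => [|n IH]; first exact: cvg_cst.
by under eq_cvg do rewrite exprS; rewrite exprS; exact: cvgM.
Qed.

Section RatioLimits.
Variables (C : numClosedFieldType) (T : Type) (F : set_system T).
Context {FF : Filter F}.
Variables (A U Z : T -> C) (a u z q : C) (b : seq C).
Hypotheses (Aa : A t @[t --> F] --> a) (Uu : U t @[t --> F] --> u).
Hypothesis den_b : forall x, x \in b -> 1 - a * q / x * u != 0.

Lemma cvg_psi_ratio :
  psi_ratio (A t) b q (U t) @[t --> F] --> psi_ratio a b q u.
Proof.
rewrite /psi_ratio; elim: b den_b => [|x s IH] den.
  by under eq_cvg do rewrite big_nil; rewrite big_nil; exact: cvg_cst.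
under eq_cvg do rewrite big_cons.
rewrite big_cons; apply: cvgM; last first.
  by apply: IH => y ys; apply: den; rewrite inE ys orbT.
apply: cvgM.
  by apply: cvgB; [exact: cvg_cst | apply: cvgM => //; exact: cvg_cst].
apply: cvgV; first by apply: den; rewrite mem_head.
apply: cvgB; first exact: cvg_cst.
apply: cvgM => //; apply: cvgM; last exact: cvg_cst.
by apply: cvgM => //; exact: cvg_cst.
Qed.

Lemma cvg_W_ratio : Z t @[t --> F] --> z ->
  1 - q * u != 0 -> 1 - a * u ^+ 2 != 0 ->
  W_ratio (A t) b q (Z t) (U t) @[t --> F] --> W_ratio a b q z u.
Proof.
move=> Zz qu au; rewrite /W_ratio.
have U2 : U t ^+ 2 @[t --> F] --> u ^+ 2 by exact: cvg_expn.
apply: cvgM => //; apply: cvgM; last exact: cvg_psi_ratio.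
apply: cvgM; apply: cvgM.
- by apply: cvgB; [exact: cvg_cst | exact: cvgM].
- apply: cvgV => //; apply: cvgB; first exact: cvg_cst.
  by apply: cvgM => //; exact: cvg_cst.
- apply: cvgB; first exact: cvg_cst.
  by apply: cvgM => //; apply: cvgM => //; exact: cvg_cst.
- by apply: cvgV => //; apply: cvgB; [exact: cvg_cst | exact: cvgM].
Qed.

End RatioLimits.

Section LimitsAtQ.
Variables (C : numClosedFieldType) (q : C) (b : seq C).
Hypothesis qX0 : q ^+ k @[k --> \oo] --> (0 : C).
Hypothesis qX1 : forall i : nat, 1 - q ^+ i.+1 != 0.
Hypothesis qb : forall (k : nat) x, x \in b -> 1 - q ^+ 2 / x * q ^+ k != 0.

Lemma psi_ratio_cvg (z : C) :
  psi_ratio q b q (q ^+ k) * z @[k --> \oo] --> z.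
Proof.
have psi_ratio0 : psi_ratio q b q 0 = 1.
  by rewrite /psi_ratio big1// => x _; rewrite !mulr0 subr0 divr1.
rewrite -[X in _ --> X]mul1r -psi_ratio0.
apply: cvgM; last exact: cvg_cst.
apply: cvg_psi_ratio => //; first exact: cvg_cst.
by move=> x _; rewrite mulr0 subr0 oner_eq0.
Qed.

Variables (T : Type) (F : set_system T).
Context {FF : Filter F}.
Variables (A Z : T -> C) (z : C).
Hypotheses (Aq : A t @[t --> F] --> q) (Zz : Z t @[t --> F] --> z).

(** Joint limit as [A] tends to [q] and [k] to infinity: at [u = 0] every factor of the ratio except
    the argument equals 1. *)
Lemma W_ratio_cvg :
  W_ratio (A p.1) b q (Z p.1) (q ^+ p.2) @[p --> (F, \oo)] --> z.
Proof.
have W_ratio0 : W_ratio q b q z 0 = z.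
  rewrite /W_ratio /psi_ratio big1.
    by rewrite expr0n !mulr0 !subr0 divr1 !mul1r.
  by move=> x _; rewrite !mulr0 subr0 divr1.
rewrite -[X in _ --> X]W_ratio0; apply: cvg_W_ratio.
- exact: (cvg_comp fst A cvg_fst Aq).
- exact: (cvg_comp snd (fun k => q ^+ k) cvg_snd qX0).
- by move=> x _; rewrite mulr0 subr0 oner_eq0.
- exact: (cvg_comp fst Z cvg_fst Zz).
- by rewrite mulr0 subr0 oner_eq0.
- by rewrite expr0n mulr0 subr0 oner_eq0.
Qed.

(** Induction through [W_termS] avoids the continuity of [sqrtC]: the ratio is rational in [a], and
    its denominators do not vanish at [a = q]. *)
Lemma W_term_cvg k : W_term (A t) b q (Z t) k @[t --> F] --> W_term q b q z k.
Proof.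
elim: k => [|k IH].
  by under eq_cvg do rewrite W_term0; rewrite W_term0; exact: cvg_cst.
under eq_cvg do rewrite W_termS.
rewrite W_termS; apply: cvgM => //; apply: cvg_W_ratio => //.
- exact: cvg_cst.
- by move=> x xb; rewrite -expr2; exact: qb.
- by rewrite -exprS.
- by rewrite -exprM -exprS.
Qed.

Lemma W_argument_cvg (c : C) r :
  A t ^+ r * q ^+ r / c @[t --> F] --> q ^+ r * q ^+ r / c.
Proof.
apply: cvgM; last exact: cvg_cst.
by apply: cvgM; [exact: cvg_expn | exact: cvg_cst].
Qed.

End LimitsAtQ.

(** * Continuity of the W-series at [q] and folding of the bilateral series *)

Theorem lemma6 (R : realType) (q : cplx R) (r : nat)
    (b : (2 * r + 1).-tuple (cplx R)) :
  0 < `|q| -> `|q| < 1 ->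
  (forall x, x \in b -> x != 0) ->
  psi_defined b [seq q ^+ 2 / x | x <- b] q ->
  (\forall a \near q^',
     Num.max `|a ^+ r * q ^+ r / \prod_(x <- b) x|
             `|q ^+ (2 * r) / \prod_(x <- b) x| < 1) ->
  [/\ \forall a \near q^',
        cvgn (series (W_term a b q (a ^+ r * q ^+ r / \prod_(x <- b) x))),
      bilateral_cvg (psi_term b [seq q ^+ 2 / x | x <- b] q
                       (q ^+ (2 * r) / \prod_(x <- b) x))
    & W a b q (a ^+ r * q ^+ r / \prod_(x <- b) x) @[a --> q^'] -->
      (1 - q)^-1 * psi b [seq q ^+ 2 / x | x <- b] q
                     (q ^+ (2 * r) / \prod_(x <- b) x)].
Proof.
move=> q0 q1 b0 bdef hmax.
have {}q0 : q != 0 by rewrite -normr_gt0.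
set z := q ^+ (2 * r) / \prod_(x <- b) x.
pose Z (a : cplx R) := a ^+ r * q ^+ r / \prod_(x <- b) x.
have Zq : Z q = z by rewrite /Z -exprD addnn -mul2n.
have z1 : `|z| < 1.
  (* The second entry of the maximum does not depend on [a], so one point of the punctured
     neighbourhood suffices. *)
  have [a] := filter_ex hmax.
  by rewrite comparable_gt_max ?real_comparable ?normr_real// => /andP[].
have q1n (i : nat) : 1 - q ^+ i.+1 != 0.
  have : `|q ^+ i.+1| < 1 by rewrite normrX exprn_ilt1.
  by rewrite subr_eq0; apply: contraTneq => <-; rewrite normr1 ltxx.
have qX0 : q ^+ k @[k --> \oo] --> (0 : cplx R) by exact: cplx_cvg_expr.
have qb (k : nat) x : x \in b -> 1 - q ^+ 2 / x * q ^+ k != 0.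
  by move=> xb; apply: bdef.1; exact: map_f.
set pt := psi_term _ _ _ _.
have ptS k : pt k.+1%:Z = psi_ratio q b q (q ^+ k) * z * pt k%:Z.
  exact: psi_termS.
have ptN k : pt (Negz k) = - q ^+ (2 * k).+1 * pt k%:Z by exact: psi_term_Negz.
have cP : cvgn (series (fun k : nat => pt k%:Z)).
  have ratio_z := @psi_ratio_cvg _ q b qX0 z.
  exact: (ratio_limit_cvg_series ptS ratio_z z1).
(* By reflection the negative half has the ratio of the positive half times [q ^+ 2], hence limit
   ratio [q ^+ 2 * z]. *)
have cN : cvgn (series (fun k : nat => pt (Negz k))).
  have ptNS k : pt (Negz k.+1) =
      psi_ratio q b q (q ^+ k) * (q ^+ 2 * z) * pt (Negz k).
    by rewrite !ptN ptS mulnS (exprD q 2); ring.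
  have ratio_q2z := @psi_ratio_cvg _ q b qX0 (q ^+ 2 * z).
  have qz1 : `|q ^+ 2 * z| < 1.
    by rewrite normrM normrX mulr_ilt1// ?exprn_ilt1// exprn_ge0.
  exact: (ratio_limit_cvg_series ptNS ratio_q2z qz1).
have idq : a @[a --> q] --> q by exact: cvg_id.
have Zc : Z a @[a --> q] --> Z q.
  exact: (@W_argument_cvg _ q _ _ _ _ idq).
have [Wcvg Wlim] : (\forall a \near q, cvgn (series (W_term a b q (Z a)))) /\
    W a b q (Z a) @[a --> q] --> W q b q (Z q).
  apply: (@ratio_series_continuous _ _ q (fun a => W_term a b q (Z a))
    (fun a k => W_ratio a b q (Z a) (q ^+ k)) (Z q)).
  - by move=> a k; exact: W_termS.
  - move=> k; exact: (@W_term_cvg _ q b q1n qb _ _ _ _ _ _ idq Zc k).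
  - exact: (@W_ratio_cvg _ q b qX0 _ _ _ _ _ _ idq Zc).
  - by rewrite Zq.
split; [exact: nbhs_dnbhs | by split |].
suff <- : W q b q (Z q) = (1 - q)^-1 * psi b [seq q ^+ 2 / x | x <- b] q z.
  exact: cvg_within_filter.
(* Folding holds already for partial sums: [n] terms of W correspond to the bilateral terms of index
   [-n] to [n - 1], paired as [k] and [-k-1]. *)
have Wseries : series (W_term q b q z) = fun n => (1 - q)^-1 *
    (series (fun k : nat => pt k%:Z) n + series (fun k : nat => pt (Negz k)) n).
  apply/funext => n; rewrite /series/= -big_split/= big_distrr/=.
  by apply: eq_bigr => k _; rewrite ptN -psi_term_W_term// -/pt; ring.
rewrite Zq; apply: (cvg_lim (@norm_hausdorff _ (cplx R))).
rewrite Wseries; apply: cvgM; first exact: cvg_cst.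
exact: (cvgD cP cN).
Qed.
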